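(* For all integers $h$ and $k$ such that $k>h>5$, and all odd integers $n\geq\max\left(3,\frac{k-h+2}{2}\right)$, there is an undirected graph $\Gamma_{h,k,n}$ of $$N=\left\lceil\frac{k-2}{h-3}\right\rceil(2n+h-3)+1\approx\frac{2nk}{h}+k$$ vertices on which HITS requires more than $$\bar t=\frac{3\ln(7/6)}{4e}\left(\frac{h-3}{2}\right)^{\frac{n-1}{2}}=h^{\Omega(n)}$$ steps to converge on $h$ of the top $k$ ranks (and the last term, $h^{\Omega(n)}$, is $h^{\Omega(N\frac{h}{k})}$ for $N\geq 2k$).
   Context: HITS on an undirected graph: each undirected edge is regarded as a pair of oppositely directed edges. HITS starts with score $1$ on every vertex, and at each step replaces the score of each vertex by the sum of the scores of its neighbours (alternately producing authority scores at odd steps and hub scores at even steps; on an undirected graph the two update rules coincide). Thus the score of a vertex $v$ after $t\ge 0$ steps is, up to normalization of the whole score vector by a positive factor (which does not affect the ranking), the number $v^t$ defined by $$v^0=1,\qquad v^{t+1}=\sum_{u\leftrightarrow v}u^t,$$ where $u\leftrightarrow v$ means that $u$ and $v$ are adjacent. Convergence in rank: let an iterative algorithm provide at every step $t\geq 0$ a score vector $[v_1^t,\dots,v_N^t]$ for the $N$ vertices $v_1,\dots,v_N$ of a graph. The set of the (weakly) top $k$ vertices at step $t$ is $$T^t_k=\{v_i : |\{v_j : v_j^t>v_i^t\}|<k\}.$$ The algorithm converges on $h$ of the top $k$ ranks in $\tau$ steps if $\left|\bigcap_{t=\tau}^{\infty}T^t_k\right|\geq h$. ''Requires more than $\bar t$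 steps to converge on $h$ of the top $k$ ranks'' means that it does not converge on $h$ of the top $k$ ranks in $\tau$ steps for any integer $0\le\tau\le\bar t$.
   Formalization: The final bound h^{Ω(Nh/k)} fails uniformly for N≥2k (k=h+1, n fixed, h→∞); it is proved, for each δ>0, when also k≥(1+δ)h or N≥(2+δ)k, with constants depending on δ. The ''≈'' is read as ratio tending to 1 as h and k/h tend to infinity. *)

(* Defs.v *)
From HB Require Import structures.
From mathcomp Require Import all_boot all_order all_algebra.
From mathcomp Require Import boolp reals sequences exp.
Set Implicit Arguments.
Unset Strict Implicit.
Unset Printing Implicit Defensive.
Import Order.TTheory GRing.Theory Num.Theory.
Local Open Scope ring_scope.

Section ConvergenceInRank.
Variables (R : realDomainType) (V : finType) (score : nat -> V -> R).

Definition weak_top (k t : nat) : {set V} :=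
  [set v | (#|[set u | (score t v < score t u)%R]| < k)%N].

(* The intersection of the sets [weak_top k t] over all t >= tau. *)
Definition stable_top (k tau : nat) : {set V} :=
  [set v | `[< forall t : nat, (tau <= t)%N -> v \in weak_top k t >]].

Definition converges_in_rank (h k tau : nat) : Prop :=
  (h <= #|stable_top k tau|)%N.

Definition requires_more_than (tbar : R) (h k : nat) : Prop :=
  forall tau : nat, tau%:R <= tbar -> ~ converges_in_rank h k tau.

End ConvergenceInRank.

(* Scores are left unnormalized: rescaling the score vector of a given step by
   a positive factor does not change the ranking at that step. *)
Fixpoint hits_score (R : realDomainType) (V : finType) (adj : rel V)
    (t : nat) (v : V) : R :=
  if t is t'.+1 then \sum_(u | adj v u) hits_score R adj t' u else 1.

Definition admissible (h k n : nat) : bool :=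
  [&& (5 < h)%N, (h < k)%N, odd n
    & Num.max 3 ((k%:R - h%:R + 2) / 2) <= n%:R :> rat].

(* The ceiling is a nonnegative integer, so the absolute value only casts it
   to nat; h - 3 is not truncated, since h > 5 wherever this is used. *)
Definition num_vertices (h k n : nat) : nat :=
  (`|Num.ceil ((k%:R - 2) / (h%:R - 3) : rat)%R| * (2 * n + (h - 3)) + 1)%N.

Definition approx_num_vertices (R : realType) (h k n : nat) : R :=
  2 * n%:R * k%:R / h%:R + k%:R.

(* n is odd, so the halving in the exponent is exact. *)
Definition hits_tbar (R : realType) (h n : nat) : R :=
  3 * ln (7 / 6) / (4 * expR 1) * ((h%:R - 3) / 2) ^+ (n.-1)./2.

(* f = h^(Omega(g)) on the parameters (h, k, n) in dom: the constant c and the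
   threshold M are uniform in all three parameters. *)
Definition is_exp_Omega (R : realType) (dom : nat -> nat -> nat -> Prop)
    (f g : nat -> nat -> nat -> R) : Prop :=
  exists c M : R, 0 < c /\
    forall h k n : nat, dom h k n -> M <= g h k n ->
      h%:R `^ (c * g h k n) <= f h k n.

(* Main.v *)
Require Import Defs.
From HB Require Import structures.
From mathcomp Require Import all_boot all_order all_algebra.
From mathcomp Require Import boolp reals sequences exp.
From mathcomp Require Import zify ring lra.
Set Implicit Arguments.
Unset Strict Implicit.
Unset Printing Implicit Defensive.
Import Order.TTheory GRing.Theory Num.Theory.
Local Open Scope ring_scope.

(* The graph is a disjoint union of ceil((k-2)/(h-3)) lollipops, each a clique
   on h-1 vertices with a path attached to one of them; the lollipops are
   identical, except that one, the winner, has a path one vertex longer.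
   The winner has the largest growth rate and at least k vertices, so
   eventually it alone fills the top k ranks. But its advantage enters at the
   far end of the path, and is damped by a factor at least (h-2)/2 at each of
   the roughly 2n steps towards the clique. For exponentially many steps the
   cliques of all lollipops therefore beat all the path vertices; as these
   cliques have at least k vertices in total, only the h-1 clique vertices of
   the winner can be in the top k from then on forever. *)

(** * Scores on a single lollipop *)

Section Lollipop.
Variables (R : realFieldType) (b : nat).

(* The score after [t] steps of the vertices of class [j] in the lollipop made
   of a clique on [b + 2] vertices and a path of [K - 1] vertices. Class 0 is
   the clique without the attachment vertex, class 1 is the attachment vertex,
   and classes 2 to [K] are the path; the value is 0 beyond [K]. *)
Fixpoint lolli (K t j : nat) : R :=
  if t is t'.+1 then
    match j with
    | 0 => b%:R * lolli K t' 0 + lolli K t' 1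
    | 1 => (b%:R + 1) * lolli K t' 0 + lolli K t' 2
    | i.+1 => if (j <= K)%N then lolli K t' i + lolli K t' j.+1 else 0
    end
  else (j <= K)%N%:R.

Lemma lolliS0 K t :
  lolli K t.+1 0 = b%:R * lolli K t 0 + lolli K t 1.
Proof. by []. Qed.

Lemma lolliS1 K t :
  lolli K t.+1 1 = (b%:R + 1) * lolli K t 0 + lolli K t 2.
Proof. by []. Qed.

Lemma lolliSS K t j : (j.+2 <= K)%N ->
  lolli K t.+1 j.+2 = lolli K t j.+1 + lolli K t j.+3.
Proof. by move=> jK; rewrite /= jK. Qed.

Lemma lolli_out K t j : (K < j.+2)%N -> lolli K t j.+2 = 0.
Proof. by case: t => [|t] Kj /=; rewrite leqNgt Kj. Qed.

Lemma lolli_ge0 K t j : 0 <= lolli K t j.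
Proof.
elim: t j => [|t IH] [|[|j]] //=; first by rewrite addr_ge0 ?mulr_ge0.
  by rewrite addr_ge0 ?mulr_ge0 ?addr_ge0.
by case: ifP => // _; apply: addr_ge0.
Qed.

Hypothesis b3 : (3 <= b)%N.

Let bR : 3 <= b%:R :> R. Proof. by rewrite ler_nat. Qed.

(* The middle inequality is only there to make the first one inductive. *)
Lemma lolli_invariants K t : (2 <= K)%N ->
  [/\ lolli K t 0 <= lolli K t 1, lolli K t 1 <= lolli K t 0 + lolli K t 2
    & forall j, lolli K t j.+2 <= lolli K t 0].
Proof.
move=> K2; elim: t => [|t [le01 le102 lej0]].
  have K1 := ltnW K2; have K0 := ltnW K1.
  by split=> [||j] /=; rewrite ?K0 ?K1 ?K2 ?lerDl //; case: leqP.
have := lolli_ge0 K t 0; have := lolli_ge0 K t 3 => f3 f0.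
have l20 := lej0 0%N; have l30 := lej0 1%N.
split=> [||j]; rewrite ?lolliS0 ?lolliS1.
- by lra.
- by rewrite lolliSS //; lra.
have f0b : 3 * lolli K t 0 <= b%:R * lolli K t 0 by rewrite ler_wpM2r.
case: (leqP j.+2 K) => [jK|Kj]; last first.
  by rewrite lolli_out //; have := lolli_ge0 K t 1; lra.
rewrite lolliSS //; have := lej0 j.+1; case: j jK => [|j] jK; first by lra.
by have := lej0 j; lra.
Qed.

Section Invariants.
Variables (K t : nat).
Hypothesis K2 : (2 <= K)%N.

Lemma lolli_le01 : lolli K t 0 <= lolli K t 1.
Proof. by case: (lolli_invariants t K2). Qed.

Lemma lolli_le10 : lolli K t 1 <= 2 * lolli K t 0.
Proof. by case: (lolli_invariants t K2) => _ + /(_ 0%N); lra. Qed.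

Lemma lolli_leSS0 j : lolli K t j.+2 <= lolli K t 0.
Proof. by case: (lolli_invariants t K2). Qed.

Lemma lolli_le0 j : lolli K t j <= 2 * lolli K t 0.
Proof.
have := lolli_ge0 K t 0.
case: j => [|[|j]]; [lra | by move=> _; exact: lolli_le10 |].
by have := lolli_leSS0 j; lra.
Qed.

Lemma lolliS_ge : (b%:R + 1) * lolli K t 0 <= lolli K t.+1 0.
Proof. by rewrite lolliS0; have := lolli_le01; lra. Qed.

Lemma lolliS_le : lolli K t.+1 0 <= (b%:R + 2) * lolli K t 0.
Proof. by rewrite lolliS0; have := lolli_le10; lra. Qed.

End Invariants.

Lemma lolli_gt0 K t : (2 <= K)%N -> 0 < lolli K t 0.
Proof.
move=> K2; elim: t => [|t IH] //; apply: lt_le_trans (lolliS_ge _ K2).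
by rewrite mulr_gt0 // ltr_wpDl.
Qed.

Lemma lolli_mono K s t : (2 <= K)%N -> lolli K s 0 <= lolli K (s + t) 0.
Proof.
move=> K2; elim: t => [|t IH]; rewrite ?addn0 // addnS.
apply: le_trans IH (le_trans _ (lolliS_ge _ K2)).
by rewrite ler_peMl ?lolli_ge0 //; have := bR; lra.
Qed.

Lemma lolliD_le K s t : (2 <= K)%N ->
  lolli K (s + t) 0 <= (b%:R + 2) ^+ t * lolli K s 0.
Proof.
move=> K2; elim: t => [|t IH]; first by rewrite addn0 mul1r.
rewrite addnS exprS -mulrA; apply: le_trans (lolliS_le _ K2) _.
by rewrite ler_wpM2l //; have := bR; lra.
Qed.

Lemma lolli_edge K t j : (j < K)%N -> lolli K t j <= lolli K t.+1 j.+1.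
Proof.
case: j => [|j] jK; last by rewrite lolliSS // lerDl lolli_ge0.
rewrite lolliS1; have := lolli_ge0 K t 0; have := lolli_ge0 K t 2.
have : 0 <= b%:R * lolli K t 0 by rewrite mulr_ge0 ?lolli_ge0.
lra.
Qed.

(** Going back [j] steps in time costs the clique a factor at most [b + 2] per step, and the score
    found there then travels forward along the [j] edges to class [j]. If time 0 is reached earlier,
    all scores there are 1. *)
Lemma lolli_harnack K t j : (2 <= K)%N -> (j <= K)%N ->
  lolli K t 0 <= (b%:R + 2) ^+ j * lolli K t j.
Proof.
move=> K2; have b2_ge1 : 1 <= b%:R + 2 :> R by have := bR; lra.
elim: t j => [|t IH] [|j] jK //; rewrite ?mul1r //.
  by rewrite [lolli K 0 j.+1]/= jK mulr1 /= exprn_ege1.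
apply: le_trans (lolliS_le _ K2) _.
rewrite exprS -mulrA ler_wpM2l //; first by lra.
apply: le_trans (IH j (ltnW jK)) _.
by rewrite ler_wpM2l ?lolli_edge // exprn_ge0 //; lra.
Qed.

End Lollipop.

(** * Upper bound on the advantage of the longer path *)

Section Comparison.
Variables (R : realFieldType) (b K : nat).
Hypotheses (b3 : (3 <= b)%N) (K2 : (2 <= K)%N).

Let bR : 3 <= b%:R :> R. Proof. by rewrite ler_nat. Qed.

Local Notation f := (lolli R b K).
Local Notation g := (lolli R b K.+1).

Let K3 : (2 <= K.+1)%N. Proof. exact: leqW. Qed.

(** [theta] is a supersolution of the path recursion: it decays by [mu] per edge from 1 at the far
    end, [mu^-1 + mu <= 2 * mu = b + 1], and the clique grows by at least [b + 1] per step. It is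
    cut to 0 at classes 0 and 1, where any gain is booked in the factor [1 + t * eta]. *)
Let mu : R := (b%:R + 1) / 2.
Let theta (j : nat) : R := if (j < 2)%N then 0 else mu ^- (K.+1 - j).
Let eta : R := mu ^- K.-1 / (b%:R + 1).

Let mu2 : 2 <= mu. Proof. by rewrite /mu; have := bR; lra. Qed.
Let mu0 : 0 < mu. Proof. by apply: lt_le_trans mu2; lra. Qed.

Let theta_ge0 j : 0 <= theta j.
Proof.
by rewrite /theta; case: ifP => // _; rewrite invr_ge0 exprn_ge0 // ltW.
Qed.

Let eta_ge0 : 0 <= eta.
Proof.
rewrite divr_ge0 ?invr_ge0 ?exprn_ge0 ?(ltW mu0) //; have := bR; lra.
Qed.

Let theta_step j : (2 <= j <= K)%N ->
  theta j.-1 + theta j.+1 <= (b%:R + 1) * theta j.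
Proof.
move=> /andP[j2 jK]; set x := mu ^- (K - j).
have x0 : 0 <= x by rewrite invr_ge0 exprn_ge0 // ltW.
have E0 : theta j = x / mu.
  by rewrite /theta ltnNge j2 /= subSn // exprSr invfM mulrC.
have E1 : theta j.+1 = x.
  by rewrite /theta ltnNge (leqW j2) /= subSS.
have E2 : theta j.-1 <= x / mu / mu.
  rewrite /theta; case: ltnP => _.
    by do 2!(apply: divr_ge0; last exact: ltW).
  rewrite (_ : (K.+1 - j.-1 = (K - j).+2)%N); last by lia.
  by rewrite !exprSr !invfM /x; lra.
apply: le_trans (lerD E2 (lexx _)) _; rewrite E0 E1.
have -> : b%:R + 1 = 2 * mu by rewrite /mu; lra.
have -> : 2 * mu * (x / mu) = 2 * x by field; rewrite gt_eqF.
suff : x / mu / mu <= x by lra.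
rewrite ler_pdivrMr // ler_pdivrMr //.
have m2 := mu2; have m4 : 2 * 2 <= mu * mu by apply: ler_pM.
by rewrite -mulrA ler_peMr //; lra.
Qed.

(* [eta] is the relative gain per step at the attachment vertex, the term
   [theta] the excess that has not yet come back from the end of the path. *)
Lemma lolli_compare t : t%:R * eta <= 2 ->
  forall j, g t j <= (1 + t%:R * eta) * f t j + f t 0 * theta j.
Proof.
have eta0 := eta_ge0; elim: t => [_|t IH te] j.
  (* Initially the two lollipops differ only at class [K.+1], where [theta] is 1. *)
  rewrite mul0r addr0 mul1r /= mul1r.
  case: (ltngtP j K.+1) => jK.
  - by rewrite -ltnS jK lerDl.
  - by rewrite addr_ge0 // ler0n.
  by rewrite jK ltnn /theta ltnNge K3 subnn expr0 invr1 add0r.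
have tt1 : t%:R * eta <= t.+1%:R * eta by rewrite ler_wpM2r // ler_nat.
have {}IH := IH (le_trans tt1 te).
set e := t%:R * eta in IH tt1 *; have -> : t.+1%:R * eta = e + eta.
  by rewrite -natr1 mulrDl mul1r.
have e0 : 0 <= e by rewrite mulr_ge0.
have Sf i : (1 + e) * f t.+1 i <= (1 + (e + eta)) * f t.+1 i.
  by rewrite ler_wpM2r ?lolli_ge0 //; lra.
have f0 := lolli_ge0 R b K t 0.
have f0' := lolliS_ge R b3 t K2.
have := IH 0%N; have := IH 1%N; have := IH 2%N.
rewrite [theta 0]/theta [theta 1]/theta !mulr0 !addr0.
move=> I2 I1 I0.
case: j => [|[|j]].
- rewrite [theta 0]/theta mulr0 addr0; apply: le_trans _ (Sf 0%N).
  rewrite !lolliS0.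
  have := ler_wpM2l (ler0n R b) I0; lra.
- rewrite [theta 1]/theta mulr0 addr0 !lolliS1.
  have b10 : 0 <= b%:R + 1 :> R by have := bR; lra.
  have H := ler_wpM2l b10 I0.
  (* This fixes [eta]: the excess [f t 0 * theta 2] arriving from the path is [eta] times the input
     [(b + 1) * f t 0] from the clique. *)
  have E : theta 2 = (b%:R + 1) * eta.
    rewrite /theta /= /eta; have -> : (K.+1 - 2 = K.-1)%N by lia.
    by rewrite mulrC divfK // gt_eqF //; have := bR; lra.
  have H2 : 0 <= eta * f t 2 by rewrite mulr_ge0 ?lolli_ge0.
  rewrite E in I2; lra.
case: (ltngtP j.+2 K.+1) => jK.
- apply: le_trans _ (lerD (Sf _) (lexx _)).
  rewrite !lolliSS //; last by exact: ltnW.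
  have H : f t 0 * (theta j.+1 + theta j.+3) <= f t.+1 0 * theta j.+2.
    apply: le_trans (_ : f t 0 * ((b%:R + 1) * theta j.+2) <= _).
      by apply: ler_wpM2l => //; apply: (@theta_step j.+2 jK).
    by rewrite mulrA ler_wpM2r // mulrC.
  by have := IH j.+1; have := IH j.+3; lra.
- rewrite lolli_out // addr_ge0 ?mulr_ge0 ?lolli_ge0 //; lra.
(* At the winner's extra vertex, [theta] alone must pay. As [e <= 2], the score is at most
   [(3 + 1/2) * f t 0], which one step of clique growth, by at least 4, covers. *)
have -> : f t.+1 j.+2 = 0 by rewrite lolli_out // jK.
have -> : g t.+1 j.+2 = g t j.+1.
  by rewrite lolliSS ?jK // -jK lolli_out ?addr0 // jK.
rewrite mulr0 add0r jK.
have -> : theta K.+1 = 1 by rewrite /theta ltnNge K3 subnn expr0 invr1.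
rewrite mulr1; apply: le_trans (IH _) _.
have jE : j.+1 = K by lia.
rewrite jE.
have [i Ki] : exists i, K = i.+2 by exists K.-2; lia.
have H1 : f t K <= f t 0 by rewrite {2}Ki lolli_leSS0.
have H2 : theta K <= 1 / 2.
  rewrite /theta ltnNge K2 /= subSnn expr1 mul1r lef_pV2 ?posrE //; lra.
have H3 : (1 + e) * f t K <= 3 * f t 0.
  apply: (@le_trans _ _ (3 * f t K)); last by rewrite ler_wpM2l.
  by rewrite ler_wpM2r ?lolli_ge0 //; lra.
have H4 := ler_wpM2l f0 H2.
have H5 : 4 * f t 0 <= (b%:R + 1) * f t 0.
  by rewrite ler_wpM2r //; have := bR; lra.
lra.
Qed.

(** The critical class is 2: it receives at most [9/8 * 2] clique scores from the attachment vertex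
    and [3/4] from class 3, in total 3, which is [3/4] of the least growth factor 4. The claim
    starts at time 1 because all scores tie at time 0. *)
Lemma lolli_path_small t : t.+1%:R * eta <= 1 / 8 ->
  forall j, g t.+1 j.+2 <= 3 / 4 * f t.+1 0.
Proof.
have eta0 := eta_ge0; elim: t => [_|t IH te] j.
  have := bR => bR'.
  rewrite /= mulr1 (leq_trans _ K2) // (_ : true%:R = 1 :> R) //.
  have : (j < K.+1)%:R <= 1 :> R by case: leqP.
  have : (j.+2 < K.+1)%:R <= 1 :> R by case: leqP.
  by case: ifP => _; lra.

have tt1 : t.+1%:R * eta <= t.+2%:R * eta by rewrite ler_wpM2r // ler_nat.
have {}IH := IH (le_trans tt1 te).
have f0 := lolli_ge0 R b K t.+1 0.
have f0' := lolliS_ge R b3 t.+1 K2.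
have H5 : 4 * f t.+1 0 <= (b%:R + 1) * f t.+1 0.
  by rewrite ler_wpM2r //; have := bR; lra.
case: (ltnP K.+1 j.+2) => jK.
  by rewrite lolli_out // mulr_ge0 ?lolli_ge0 //; lra.
rewrite lolliSS //; case: j jK => [|j] jK; last first.
  by have := IH j; have := IH j.+2; lra.
have te2 : t.+1%:R * eta <= 2 by lra.
have te0 : 0 <= t.+1%:R * eta by rewrite mulr_ge0 ?ler0n.
have := IH 1%N; have := lolli_compare te2 1.
rewrite [theta 1]/theta mulr0 addr0.
have : (1 + t.+1%:R * eta) * f t.+1 1 <= 9 / 8 * (2 * f t.+1 0).
  by apply: ler_pM; rewrite ?lolli_ge0 ?lolli_le10 //; lra.
lra.
Qed.

End Comparison.

(** * Eventual victory of the longer lollipop *)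

Section Dominance.
Variables (R : realType) (b K : nat).
Hypotheses (b3 : (3 <= b)%N) (K2 : (2 <= K)%N).

Let bR : 3 <= b%:R :> R. Proof. by rewrite ler_nat. Qed.

Local Notation f := (lolli R b K).
Local Notation g := (lolli R b K.+1).

Let K3 : (2 <= K.+1)%N. Proof. exact: leqW. Qed.

Definition dominates (r : R) (t : nat) := forall j, r * f t j <= g t j.

Lemma dominates0 : dominates 1 0.
Proof.
by move=> j; rewrite mul1r /= ler_nat; case: (leqP j K) => // jK; rewrite leqW.
Qed.

(** A surplus [x] beyond the ratio [r] moves one class towards the clique per step, since the other
    neighbours contribute at least their share [r]. *)
Lemma dominates_shift r t x j : 0 <= x -> (j <= K)%N -> dominates r t ->
  r * f t j.+1 + x <= g t j.+1 -> r * f t.+1 j + x <= g t.+1 j.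
Proof.
move=> x0 jK dom domx; case: j jK domx => [|[|j]] jK domx.
- rewrite !lolliS0.
  have := ler_wpM2l (ler0n R b) (dom 0%N); lra.
- rewrite !lolliS1; have b10 : 0 <= b%:R + 1 :> R by have := bR; lra.
  have := ler_wpM2l b10 (dom 0%N); lra.
rewrite !lolliSS //; last exact: leqW.
by have := dom j.+1; lra.
Qed.

Lemma dominatesS r t : dominates r t -> dominates r t.+1.
Proof.
move=> dom j; case: (leqP j K) => jK.
  rewrite -[leLHS]addr0; apply: dominates_shift => //.
  by rewrite addr0; apply: dom.
case: j jK => // -[|j] jK; first by move: (leq_trans K2 (ltnW jK)); lia.
by rewrite lolli_out // mulr0 lolli_ge0.
Qed.

Lemma dominatesD r t s : dominates r t -> dominates r (s + t).
Proof. by move=> dom; elim: s => // s IH; apply: dominatesS. Qed.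

(* The winner's extra vertex receives [r * f t K] at the first step, which then
   travels back along the path. *)
Lemma dominates_excess r t i : 0 <= r -> (i <= K.+1)%N -> dominates r t ->
  r * f (i + t.+1) (K.+1 - i) + r * f t K <= g (i + t.+1) (K.+1 - i).
Proof.
move=> r0 + dom; elim: i => [_|i IH iK].
  rewrite subn0 add0n; have [k Kk] : exists k, K = k.+1 by exists K.-1; lia.
  rewrite Kk lolli_out // mulr0 add0r lolliSS // -Kk.
  by rewrite -[leLHS]addr0 lerD ?dom ?lolli_ge0.
rewrite addSn; apply: dominates_shift.
- by rewrite mulr_ge0 ?lolli_ge0.
- by rewrite leq_subLR; lia.
- by rewrite -addSnnS; apply: dominatesD.
by rewrite -subSn // subSS; apply: IH; exact: ltnW.
Qed.

(** A lower bound for the excess [f _ K] relative to any score [K.+2] steps later: the factor 2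
    compares that score with the clique, [K.+2] powers undo the growth, and [K] powers lead from the
    clique to the path's end. *)
Let kappa : R := (b%:R + 2) ^- (K + K.+2) / 2.

Lemma dominates_boost r t : 0 <= r -> dominates r t ->
  dominates (r * (1 + kappa)) (t + K.+2).
Proof.
move=> r0 dom j; have b20 : 0 < b%:R + 2 :> R by have := bR; lra.
case: (leqP j K) => jK; last first.
  case: j jK => // -[|j] jK; first by lia.
  by rewrite lolli_out // mulr0 lolli_ge0.
(* Waiting [j] steps before the excess starts makes it arrive at every class [j] at the same time
   [t + K.+2]. *)
have domj : dominates r (j + t) by apply: dominatesD.
have := @dominates_excess r (j + t) (K.+1 - j) r0 (leq_subr _ _) domj.
rewrite subKn; last exact: leqW.
rewrite (_ : (K.+1 - j + (j + t).+1 = t + K.+2)%N); last by lia.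
apply: le_trans; rewrite mulrDr mulr1 mulrDl lerD2l -mulrA ler_wpM2l //.
rewrite /kappa mulrAC ler_pdivrMr // mulrC ler_pdivrMr ?exprn_gt0 //.
apply: le_trans (lolli_le0 R b3 _ K2 _) _.

have -> : forall x y z : R, x * y * z = y * (z * x) by move=> *; ring.
rewrite ler_pM2l // exprD mulrAC.
apply: le_trans (lolliD_le R b3 _ _ K2) _.
rewrite [leRHS]mulrC; apply: ler_wpM2l; first by rewrite exprn_ge0 // ltW.
apply: le_trans (lolli_mono R b3 t j K2) _.
by rewrite addnC; apply: lolli_harnack.
Qed.

Lemma kappa_gt0 : 0 < kappa.
Proof.
by rewrite divr_gt0 // invr_gt0 exprn_gt0 //; have := bR; lra.
Qed.

Lemma dominates_iter i : dominates ((1 + kappa) ^+ i) (i * K.+2).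
Proof.
elim: i => [|i IH]; first exact: dominates0.
rewrite exprSr mulSn addnC; apply: dominates_boost => //.
by rewrite exprn_ge0 //; have := kappa_gt0; lra.
Qed.

Lemma lolli_eventually_dominates tau : exists2 t, (tau <= t)%N &
  forall i j, (j <= K.+1)%N -> f t i < g t j.
Proof.
have k0 := kappa_gt0; have b20 : 0 < b%:R + 2 :> R by have := bR; lra.
(* [c] bounds the spread of scores: any class is at most twice the clique, and the winner's clique
   at most [(b + 2) ^+ K.+1] times any winner vertex. The ratio [(1 + kappa) ^+ i] has to exceed
   it. *)
set c := 2 * (b%:R + 2) ^+ K.+1 : R.
have [N Nc] : exists N : nat, c / kappa < N%:R.
  exists (Num.truncn (c / kappa)).+1; exact: truncnS_gt.
exists ((tau + N) * K.+2)%N => [|i j jK]; first by lia.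
set t := ((tau + N) * K.+2)%N.
have dom := dominates_iter (tau + N) 0%N; rewrite -/t in dom.
have f0 : 0 < f t 0 by apply: lolli_gt0.
apply: le_lt_trans (lolli_le0 R b3 _ K2 _) _.
rewrite -(ltr_pM2l (exprn_gt0 K.+1 b20)).
apply: lt_le_trans (_ : g t 0 <= _); last first.
  apply: le_trans (lolli_harnack R b3 t K3 jK) _.
  rewrite ler_wpM2r ?lolli_ge0 // ler_weXn2l //; have := bR; lra.
apply: lt_le_trans dom.
rewrite mulrA [_ * 2]mulrC -/c ltr_pM2r //.
have bern i' : i'%:R * kappa <= (1 + kappa) ^+ i'.
  elim: i' => [|i' IH]; first by rewrite mul0r.
  rewrite -natr1 mulrDl mul1r exprSr mulrDr mulr1 lerD //.
  by rewrite ler_peMl ?exprn_ege1 //; lra.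
apply: lt_le_trans (bern _); rewrite -ltr_pdivrMr //; apply: lt_le_trans Nc _.
by rewrite ler_nat leq_addl.
Qed.

End Dominance.

(** * Adjacency of a lollipop and its class recursion *)

(* Vertices below [s] form the clique, and the path continues from [s - 1]. *)
Definition lollipop_adj (s a c : nat) : bool :=
  (a != c) && [|| (a < s)%N && (c < s)%N, a.+1 == c | c.+1 == a].

Lemma lollipop_adjC s a c : lollipop_adj s a c = lollipop_adj s c a.
Proof. by rewrite /lollipop_adj; lia. Qed.

Lemma lollipop_adjxx s a : lollipop_adj s a a = false.
Proof. by rewrite /lollipop_adj eqxx. Qed.

Section LollipopScore.
Variables (R : realType) (b K : nat).
Hypothesis K2 : (2 <= K)%N.

Lemma sum_ord_delta n (F : nat -> R) i :
  \sum_(j < n) (if i == j :> nat then F j else 0)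
  = if (i < n)%N then F i else 0.
Proof.
rewrite -big_mkcond /=; under eq_bigl do rewrite eq_sym.
by rewrite (big_ord1_eq _ F i n); case: ifP; rewrite ?addr0.
Qed.

(** Truncated subtraction makes [a - b] the class of vertex [a]: it is 0 on the first [b.+1] clique
    vertices and 1 at the attachment vertex [b.+1]. The sum is split at that vertex. *)
Lemma lolli_sum t a : (a < b.+1 + K)%N ->
  \sum_(c < b.+1 + K | lollipop_adj b.+2 a c) lolli R b K t (c - b)
  = lolli R b K t.+1 (a - b).
Proof.
move=> aM; set f := lolli R b K t.
pose G c := if lollipop_adj b.+2 a c then f (c - b)%N else 0.
rewrite big_mkcond (eq_bigr (fun i : 'I__ => G i)) // big_split_ord [LHS]/=.
case: (ltngtP a b.+1) => ab.
- have -> : (a - b = 0)%N by lia.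
  rewrite lolliS0; congr (_ + _).
    rewrite (eq_bigr (fun i : 'I_b.+1 => if i != Ordinal ab then f 0%N else 0)).
      by rewrite -big_mkcond /= sumr_const cardC1 card_ord mulr_natl.
    move=> i _; have ib := ltn_ord i.
    rewrite /G /lollipop_adj -val_eqE /= eq_sym.
    have -> : (i - b = 0)%N by lia.
    by case: eqP => //=; case: ifP => //; lia.
  rewrite (eq_bigr (fun i : 'I_K => if 0%N == i :> nat then f i.+1 else 0)).
    by rewrite (sum_ord_delta _ (fun i => f i.+1)) ltnW.
  move=> i _; rewrite /G /lollipop_adj /=.
  have -> : (b.+1 + i - b = i.+1)%N by lia.
  by congr (if _ then _ else _); lia.
- have [i ai] : exists i, a = (b.+2 + i)%N by exists (a - b.+2)%N; lia.
  rewrite big1 ?add0r => [|j _]; last first.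
    by have jb := ltn_ord j; rewrite /G /lollipop_adj ai; case: ifP => //; lia.
  have -> : (a - b = i.+2)%N by lia.
  rewrite lolliSS; last by lia.
  rewrite (eq_bigr (fun j : 'I_K => (if i == j :> nat then f j.+1 else 0)
    + (if i.+2 == j :> nat then f j.+1 else 0))).
    rewrite big_split !(sum_ord_delta _ (fun i => f i.+1)).
    rewrite (_ : (i < K)%N); last by lia.
    by case: ltnP => // iK; rewrite /f lolli_out.
  move=> j _; rewrite /G /lollipop_adj ai /=.
  have -> : (b.+1 + j - b = j.+1)%N by lia.
  case: (eqVneq i j) => [->|ij].
    by rewrite ifT ?ifF ?addr0 //; lia.
  by rewrite add0r; congr (if _ then _ else _); lia.
rewrite ab (_ : (b.+1 - b = 1)%N); last by lia.
rewrite lolliS1; congr (_ + _).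
  rewrite (eq_bigr (fun=> f 0%N)).
    by rewrite sumr_const card_ord natr1 mulr_natl.
  move=> i _; have ib := ltn_ord i; rewrite /G /lollipop_adj ab.
  have -> : (i - b = 0)%N by lia.
  by rewrite ifT //; lia.
rewrite (eq_bigr (fun i : 'I_K => if 1%N == i :> nat then f i.+1 else 0)).
  by rewrite (sum_ord_delta _ (fun i => f i.+1)) K2.
move=> i _; rewrite /G /lollipop_adj ab /=.
have -> : (b.+1 + i - b = i.+1)%N by lia.
by congr (if _ then _ else _); lia.
Qed.

End LollipopScore.

(** * The whole graph and its stable top ranks *)

Section HitsGraph.
Variables (R : realType) (b K m : nat).
Hypotheses (b3 : (3 <= b)%N) (K2 : (2 <= K)%N).

Definition hits_vertex : finType :=
  ('I_(b.+1 + K.+1) + 'I_m * 'I_(b.+1 + K))%type.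

Definition hits_adj : rel hits_vertex := fun x y =>
  match x, y with
  | inl a, inl c => lollipop_adj b.+2 a c
  | inr (i, a), inr (j, c) => (i == j) && lollipop_adj b.+2 a c
  | _, _ => false
  end.

Lemma hits_adj_sym : symmetric hits_adj.
Proof.
move=> [a|[i a]] [c|[j c]] //=; first exact: lollipop_adjC.
by rewrite eq_sym lollipop_adjC.
Qed.

Lemma hits_adj_irr : irreflexive hits_adj.
Proof. by move=> [a|[i a]] /=; rewrite lollipop_adjxx ?andbF. Qed.

Definition hits_lolli t (x : hits_vertex) : R :=
  match x with
  | inl a => lolli R b K.+1 t (a - b)
  | inr (_, a) => lolli R b K t (a - b)
  end.

Lemma hits_scoreE t x : hits_score R hits_adj t x = hits_lolli t x.
Proof.
elim: t x => [|t IH] x.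
  case: x => [a|[i a]] /=; have aM := ltn_ord a.
    by rewrite (_ : (_ <= _)%N) //; lia.
  by rewrite (_ : (_ <= _)%N) //; lia.
rewrite [LHS]/= (eq_bigr (hits_lolli t)) // big_sumType /=.
case: x => [a|[i a]].
  rewrite /= [X in _ + X]big_pred0 // addr0.
  exact: (@lolli_sum R b K.+1 (leqW K2) t a (ltn_ord a)).
rewrite [X in X + _]big_pred0 // add0r.
rewrite (eq_big (fun p : 'I_m * 'I_(b.+1 + K) =>
    pred1 i p.1 && lollipop_adj b.+2 a p.2)
  (fun p => lolli R b K t (p.2 - b))); last 2 first.
- by case=> j c /=; rewrite eq_sym.
- by case.
rewrite -(pair_big (pred1 i) (fun c : 'I__ => lollipop_adj b.+2 a c)
  (fun _ c => lolli R b K t (c - b))) /= big_pred1_eq.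
exact: (@lolli_sum R b K K2 t a (ltn_ord a)).
Qed.

(** Two times suffice. At [tau.+1], at least [k] clique vertices of all lollipops beat each path
    vertex of the winner; at some later time, the at least [k] vertices of the winner beat all
    others. Only the winner's clique survives both. *)
Lemma hits_stable k tau :
  (k <= m.+1 * b.+2)%N -> (k <= b.+1 + K.+1)%N ->
  (forall j, lolli R b K.+1 tau.+1 j.+2 < lolli R b K tau.+1 0) ->
  (#|stable_top (hits_score R hits_adj) k tau| <= b.+2)%N.
Proof.
move=> km kB small.
have wid2 : (b.+2 <= b.+1 + K.+1)%N by lia.
rewrite -[X in (_ <= X)%N]card_ord.
apply: leq_trans (leq_imset_card
  (fun i : 'I_b.+2 => inl (widen_ord wid2 i) : hits_vertex) predT).
apply: subset_leq_card.
apply/subsetP => v; rewrite inE => /asboolP stv.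
case: v stv => [a|[i a]] stv.
  case: (ltnP a b.+2) => ab.
    apply/imsetP; exists (Ordinal ab) => //; congr (inl _); exact: val_inj.
  have := stv tau.+1 (leqnSn _); rewrite inE ltnNge => /negP[].
  apply: leq_trans km _.
  have wid1 : (b.+2 <= b.+1 + K)%N by lia.
  pose phi (x : 'I_b.+2 + 'I_m * 'I_b.+2) : hits_vertex := match x with
    | inl c => inl (widen_ord wid2 c)
    | inr (j, c) => inr (j, widen_ord wid1 c) end.
  have phi_inj : injective phi.
    move=> [c|[j c]] [c'|[j' c']] //= [].
      by move=> /val_inj ->.
    by move=> -> /val_inj ->.
  have <- : #|{: 'I_b.+2 + 'I_m * 'I_b.+2}| = (m.+1 * b.+2)%N.
    by rewrite card_sum card_prod !card_ord mulSn.
  rewrite -(card_imset predT phi_inj).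
  apply/subset_leq_card/subsetP => _ /imsetP[x _ ->].
  rewrite inE !hits_scoreE [X in X < _]/=.
  have [j ->] : exists j, (a - b = j.+2)%N by exists (a - b.+2)%N; lia.
  apply: lt_le_trans (small j) _.
  (* With ratio 1, the winner's clique scores are at least those of the losers, so the bound by a
     loser's clique score serves for all cliques. *)
  have dom : @dominates R b K 1 tau.+1.
    by rewrite -[tau.+1]addn0; apply: dominatesD => //; apply: dominates0.
  have f01 := lolli_le01 R b3 tau.+1 K2.
  case: x => [c|[i c]] /=; have := ltn_ord c.
    rewrite -[X in X <= _]mul1r leq_eqVlt ltnS => /orP[/eqP[->]|cb].
      by rewrite subSnn; apply: le_trans (dom 1%N); rewrite !mul1r.
    have /eqP-> : (c - b == 0)%N by rewrite subn_eq0.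
    exact: (dom 0%N).
  rewrite leq_eqVlt ltnS => /orP[/eqP[->]|cb]; first by rewrite subSnn.
  have /eqP-> : (c - b == 0)%N by rewrite subn_eq0.
  exact: lexx.
have [t taut lt_fg] := lolli_eventually_dominates R b3 K2 tau.
have := stv t taut; rewrite inE ltnNge => /negP[].
apply: leq_trans kB _; rewrite -[X in (X <= _)%N]card_ord.
rewrite -(card_imset predT (@inl_inj _ ('I_m * 'I_(b.+1 + K))%type)).
apply/subset_leq_card/subsetP => _ /imsetP[c _ ->].
by rewrite inE !hits_scoreE /=; apply: lt_fg; have := ltn_ord c; lia.
Qed.

End HitsGraph.

(** * Renumbering the vertices, and arithmetic of the parameters *)

Lemma requires_more_than_bij (R : realDomainType) (V W : finType)
    (psi : W -> V) (s : nat -> V -> R) (s' : nat -> W -> R) tbar h k :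
  bijective psi -> (forall t w, s' t w = s t (psi w)) ->
  requires_more_than s tbar h k -> requires_more_than s' tbar h k.
Proof.
move=> bij ss' req tau /req + conv; apply.
apply: leq_trans conv _; rewrite -(card_imset _ (bij_inj bij)).
apply/subset_leq_card/subsetP => _ /imsetP[w + ->].
rewrite !inE => /asboolP st; apply/asboolP => t /st; rewrite !inE.
rewrite -(card_imset _ (bij_inj bij)); apply: leq_trans; rewrite ltnS.
apply/subset_leq_card/subsetP => v; rewrite inE => lt_v.
have [phi phiK psiK] := bij; apply/imsetP; exists (phi v) => //.
by rewrite inE !ss' psiK.
Qed.

Lemma hits_score_bij (R : realDomainType) (V W : finType) (psi : W -> V)
    (adj : rel V) : bijective psi ->
  forall t w, hits_score R (relpre psi adj) t w = hits_score R adj t (psi w).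
Proof.
move=> bij; elim=> //= t IH w.
rewrite (reindex psi) /=; last exact: onW_bij.
by apply: eq_bigr => u _; apply: IH.
Qed.

Lemma admissibleP h k n : admissible h k n ->
  [/\ (6 <= h)%N, (h < k)%N, odd n, (3 <= n)%N & (k + 2 <= 2 * n + h)%N].
Proof.
case/and4P => h5 hk on; rewrite ge_max => /andP[n3 kn]; split => //.
  by rewrite -(ler_nat rat).
rewrite -(ler_nat rat) natrD (natrD _ (2 * n)%N) natrM; lra.
Qed.

(** [m.+1] is the ceiling, hence the number of lollipops; each has [2 * n + (h - 3)] vertices, and
    the final 1 is the winner's extra vertex. *)
Lemma num_verticesP h k n : admissible h k n -> exists m : nat,
  [/\ num_vertices h k n = (m.+1 * (2 * n + (h - 3)) + 1)%N,
      (k <= m.+1 * (h - 3) + 2)%N & (m * (h - 3) + 2 < k)%N].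
Proof.
case/admissibleP => h6 hk _ _ _.
have hE : h%:R - 3 = (h - 3)%:R :> rat by rewrite natrB //; lia.
have h0 : 0 < (h - 3)%:R :> rat by rewrite ltr0n; lia.
set x : rat := (k%:R - 2) / (h%:R - 3).
have k2 : 2 < k%:R :> rat by rewrite ltr_nat; lia.
have x0 : 0 < x by rewrite divr_gt0 ?hE // subr_gt0.
have c0 : 0 < Num.ceil x by rewrite Num.Theory.ceil_gt0.
have [m mE] : exists m : nat, Num.ceil x = m.+1%:Z.
  by case: (Num.ceil x) c0 => [[|m]|m] // _; exists m.
have /andP[] := Num.Theory.ceil_itv x; rewrite mE.
rewrite /x hE ler_pdivrMr // ltr_pdivlMr // => lo hi.
exists m; split; first by rewrite /num_vertices -/x mE.
- rewrite -(ler_nat rat) natrD natrM; move: hi; rewrite -pmulrn; lra.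
rewrite -(ltr_nat rat) natrD natrM.
suff <- : (m.+1%:Z - 1)%:~R = m%:R :> rat by lra.
by rewrite -addn1 PoszD addrK.
Qed.

(** * The step bound against the damping of the path *)

Section Tbar.
Variable R : realType.

Let C0 : R := 3 * ln (7 / 6) / (4 * expR 1).

Lemma tbar_const_gt0 : 0 < C0.
Proof.
rewrite divr_gt0 ?mulr_gt0 ?expR_gt0 // ln_gt0 //; lra.
Qed.

Lemma tbar_const_le : C0 <= 1 / 8.
Proof.
have l : ln (7 / 6 : R) <= 1 / 6.
  by rewrite (_ : 7 / 6 = 1 + 1 / 6); [apply: le_ln1Dx; lra | lra].
have e := expR_ge1Dx (1 : R).
rewrite ler_pdivrMr; lra.
Qed.

(** The right-hand side has the form [mu ^+ K.-1 / 8] that the path comparison allows. There is much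
    room, as its exponent is four times that of [hits_tbar]. *)
Lemma hits_tbar_le h n : (6 <= h)%N ->
  hits_tbar R h n <= ((h%:R - 2) / 2) ^+ (2 * n - 2) / 8.
Proof.
move=> h6; have hR : 6 <= h%:R :> R by rewrite ler_nat.
have [c0 c8] := (tbar_const_gt0, tbar_const_le).
have B0 : 0 <= ((h%:R - 3) / 2) ^+ (n.-1)./2 :> R by rewrite exprn_ge0 //; lra.
apply: (@le_trans _ _ (1 / 8 * ((h%:R - 3) / 2) ^+ (n.-1)./2)).
  exact: ler_wpM2r.
rewrite mulrC mul1r ler_pM2r ?invr_gt0 //.
apply: (@le_trans _ _ (((h%:R - 2) / 2) ^+ (n.-1)./2)).
  by apply: lerXn2r; rewrite ?nnegrE; lra.
by apply: ler_weXn2l; [lra | lia].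
Qed.

End Tbar.

Lemma slow_hits_graph (R : realType) h k n : admissible h k n ->
  exists adj : rel 'I_(num_vertices h k n),
    [/\ symmetric adj, irreflexive adj
      & requires_more_than (hits_score R adj) (hits_tbar R h n) h k].
Proof.
move=> adm; have [h6 hk on n3 kn] := admissibleP adm.
have [m [NE km _]] := num_verticesP adm.
(* The cliques get [b + 2 = h - 1] vertices, one too few for convergence on [h] ranks, and each
   loser gets [b + 1 + K = 2 * n + (h - 3)]. *)
set b := (h - 3)%N; set K := (2 * n - 1)%N.
have b3 : (3 <= b)%N by rewrite /b; lia.
have K2 : (2 <= K)%N by rewrite /K; lia.
have cardV : num_vertices h k n = #|hits_vertex b K m|.
  by rewrite NE card_sum card_prod !card_ord /b /K; nia.
pose psi i := enum_val (cast_ord cardV i).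
have psi_bij : bijective psi.
  apply: bij_comp; first exact: enum_val_bij.
  by exists (cast_ord (esym cardV)); [exact: cast_ordK | exact: cast_ordKV].
exists (relpre psi (@hits_adj b K m)); split.
- by move=> x y; apply: hits_adj_sym.
- by move=> x; apply: hits_adj_irr.
apply: (requires_more_than_bij psi_bij (hits_score_bij R _ psi_bij)).
move=> tau tau_le; apply/negP; rewrite -ltnNge.
apply: (@leq_trans b.+3); last by rewrite /b; lia.
rewrite ltnS; apply: hits_stable => //.
- by apply: (leq_trans km); rewrite /b; nia.
- by rewrite /b /K; lia.
move=> j; have bE : b%:R = h%:R - 3 :> R by rewrite natrB //; lia.
have hR : 6 <= h%:R :> R by rewrite ler_nat.
apply: le_lt_trans (lolli_path_small b3 K2 _ j) _; last first.
  by have := lolli_gt0 R b3 tau.+1 K2; lra.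
have := le_trans tau_le (hits_tbar_le R n h6).
have -> : ((b%:R + 1) / 2 = (h%:R - 2) / 2 :> R) by rewrite bE; lra.
have -> : K.-1 = (2 * n - 2)%N by rewrite /K; lia.
set X : R := _ ^+ (2 * n - 2) => tX.
(* Large [X] absorbs the extra step in [tau.+1]: what is needed is
   [X / 8 + 1 <= (h - 2) * X / 8]. *)
have X16 : 16 <= X.
  have -> : 16 = 2 ^+ 4 :> R by rewrite -natrX.
  apply: (@le_trans _ _ (((h%:R - 2) / 2) ^+ 4)).
    by apply: lerXn2r; rewrite ?nnegrE; lra.
  by apply: ler_weXn2l; [lra | lia].
rewrite mulrA ler_pdivrMr ?bE; last by lra.
rewrite ler_pdivrMr; last by lra.
have : 4 * X <= (h%:R - 3 + 1) * X by apply: ler_wpM2r; lra.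
rewrite -natr1; lra.
Qed.

(** * Asymptotics of the size and of the step bound *)

Section Asymptotics.
Variable R : realType.

Lemma num_vertices_boundsR h k n : admissible h k n ->
  exists m : nat, let mR := m%:R : R in let hR := h%:R : R in
    [/\ (num_vertices h k n)%:R = (mR + 1) * (2 * n%:R + (hR - 3)) + 1,
        k%:R <= (mR + 1) * (hR - 3) + 2, mR * (hR - 3) + 2 <= k%:R,
        mR * hR <= 2 * k%:R & (0 < m)%N].
Proof.
move=> adm; have [h6 hk _ _ _] := admissibleP adm.
have [m [NE km mk]] := num_verticesP adm; exists m => /=.
have hE : (h - 3)%:R = h%:R - 3 :> R by rewrite natrB //; lia.
have hR6 : 6 <= h%:R :> R by rewrite ler_nat.
have mk' : m%:R * (h%:R - 3) + 2 <= k%:R :> R.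
  by rewrite -hE -natrM -natrD ler_nat ltnW.
split => //.
- by rewrite NE natrD natrM natrD natrM hE natr1.
- by rewrite -hE natr1 -natrM -natrD ler_nat.
- have : 0 <= m%:R * (h%:R - 6) :> R by rewrite mulr_ge0 ?ler0n ?subr_ge0.
  lra.
by case: m {NE mk mk'} km => //; lia.
Qed.

Lemma num_vertices_approx (eps : R) : 0 < eps ->
  exists M : nat, forall h k n : nat, admissible h k n ->
    (M <= h)%N -> (M * h <= k)%N ->
    `|(num_vertices h k n)%:R - approx_num_vertices R h k n|
       <= eps * approx_num_vertices R h k n.
Proof.
move=> eps0; set M := (Num.truncn (8 / eps)).+1; exists M => h k n adm Mh Mk.
have [h6 hk _ n3 _] := admissibleP adm.
have [m [-> km mk mh m0]] := num_vertices_boundsR adm.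
have ME : 8 <= eps * M%:R.
  by rewrite mulrC -ler_pdivrMr // ltW // truncnS_gt.
have : M%:R <= h%:R :> R by rewrite ler_nat.
have : M%:R * h%:R <= k%:R :> R by rewrite -natrM ler_nat.
have : 6 <= h%:R :> R by rewrite ler_nat.
have : h%:R <= k%:R :> R by rewrite ler_nat ltnW.
have : 1 <= m%:R :> R by rewrite ler1n.
have : 3 <= n%:R :> R by rewrite ler_nat.
rewrite /approx_num_vertices.
move: (M%:R : R) (h%:R : R) (k%:R : R) (m%:R : R) (n%:R : R) ME km mk mh.
move=> {m0 n3 hk h6 Mh Mk adm M m n h k}.
move=> M h k m n ME km mk mh n3 m1 hk h6 Mk Mh.
have h0 : 0 < h by lra.
(* Over the common denominator [h], the approximation becomes [k * u] with [u = 2 * n + h]. *)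
have -> : 2 * n * k / h + k = k * (2 * n + h) / h by field; lra.
rewrite mulrA -[X in `|X - _|](mulfK (lt0r_neq0 h0)) -mulrBl normrM.
rewrite [X in _ * X]gtr0_norm ?invr_gt0 // ler_pM2r ?invr_gt0 //.
have ehk : 8 * h <= eps * k.
  apply: le_trans (_ : eps * (M * h) <= _); last by rewrite ler_pM2l.
  by rewrite mulrA ler_pM2r.
have eh : 8 <= eps * h by apply: le_trans ME _; rewrite ler_pM2l.
have em : 8 * m <= 2 * (eps * k).
  apply: le_trans (_ : eps * h * m <= _); first by rewrite ler_wpM2r //; lra.
  have := ler_wpM2l (ltW eps0) mh; lra.
set u := 2 * n + h; have u6 : 6 <= u by rewrite /u; lra.
have u0 : 0 <= u by lra.
have ek : 0 <= eps * k by rewrite mulr_ge0; lra.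
have eku : eps * k <= eps * k * u by rewrite ler_peMr //; lra.
rewrite ler_norml; apply/andP; split.
  have H1 : 0 <= (m + 1) * n * 6 by rewrite !mulr_ge0; lra.
  have H2 : (k - 2) * u <= (m + 1) * (h - 3) * u by rewrite ler_wpM2r //; lra.
  have H3 : 2 * u <= eps * k * u by rewrite ler_wpM2r //; lra.
  move: H2 H3; rewrite /u; lra.
(* Of the eight parts of [eps * k], six pay for [3 * m], one for the rounding term [h], and the last
   for the extra vertex. *)
have H1 : (m + 1) * h * u <= (k + 7 / 8 * (eps * k)) * u.
  by rewrite ler_wpM2r //; lra.
have H2 : 0 <= (m + 1) * h by rewrite mulr_ge0; lra.
move: H1 eku; rewrite /u; lra.
Qed.

Lemma tbar_ge_powR : exists c M : R, 0 < c /\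
  forall h k n : nat, admissible h k n -> M <= n%:R ->
    h%:R `^ (c * n%:R) <= hits_tbar R h n.
Proof.
have C0 := tbar_const_gt0 R; set C := 3 * _ / _ in C0.
have l2 : 0 < ln 2 :> R by rewrite ln_gt0 // ltr1n.
(* With [n = 2 * e + 1] and [x = (h - 3) / 2], the bound [h <= x ^+ 8] gives [x ^+ e] at least [h]
   to the [e / 8]. Half of this exponent outweighs [C] once [e] reaches [16 / (C * ln 2)]; the other
   half, [e / 16], is at least [n / 48]. *)
exists (1 / 48), (2 * (16 / (C * ln 2)) + 1); split; first by lra.
move=> h k n /admissibleP[h6 _ on n3 _] Mn.
have [e nE] : exists e : nat, n = e.*2.+1.
  by exists n./2; rewrite -[LHS]odd_double_half on add1n.
have e0 : (0 < e)%N by lia.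
have hR : 6 <= h%:R :> R by rewrite ler_nat.
rewrite /hits_tbar -/C nE /= doubleK; clearbody C.
set x := (h%:R - 3) / 2; have x3 : 3 / 2 <= x by rewrite /x; lra.
have hx : h%:R `^ (1 / 8) <= x.
  have x2 : 3 / 2 * x <= x * x by rewrite ler_wpM2r //; lra.
  have x8 : h%:R <= x ^+ 8.
    have x4 : 5 <= x ^+ 4.
      rewrite (_ : x ^+ 4 = (x * x) * (x * x)); last by ring.
      apply: le_trans (_ : 9 / 4 * (9 / 4) <= _); first by lra.
      by apply: ler_pM; lra.
    have -> : h%:R = 2 * x + 3 by rewrite /x; lra.
    rewrite (_ : x ^+ 8 = x ^+ 4 * (x * x * (x * x))); last by ring.
    apply: le_trans (_ : 5 * (9 / 4 * (3 / 2 * x)) <= _); first by lra.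
    apply: ler_pM; [lra | lra | exact: x4 |].
    by apply: ler_pM; lra.
  apply: le_trans (_ : (x ^+ 8) `^ (1 / 8) <= _).
    by apply: ge0_ler_powR; rewrite ?nnegrE ?exprn_ge0 //; lra.
  rewrite -powR_mulrn; last by lra.
  by rewrite -powRrM (_ : 8 * (1 / 8) = 1) ?powRr1 //; lra.
have hx' : h%:R `^ (e%:R / 8) <= x ^+ e.
  rewrite (_ : e%:R / 8 = 1 / 8 * e%:R); last by lra.
  rewrite powRrM powR_mulrn ?powR_ge0 //.
  by apply: lerXn2r; rewrite ?nnegrE ?powR_ge0 //; lra.
apply: le_trans (_ : C * h%:R `^ (e%:R / 8) <= _); last by rewrite ler_pM2l.
have -> : e%:R / 8 = e%:R / 16 + e%:R / 16 :> R by lra.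
have hn0 : h%:R != 0 :> R by apply/eqP; lra.
rewrite powRD; last by rewrite hn0 implybT.
have e1 : 1 <= e%:R :> R by rewrite ler1n.
have n2e : (e.*2.+1)%:R = 2 * e%:R + 1 :> R by rewrite -natr1 -mul2n natrM.
apply: le_trans (_ : 1 * h%:R `^ (e%:R / 16) <= _).
  by rewrite [leRHS]mul1r; apply: ler_powR; [lra | rewrite n2e; lra].
rewrite mulrA ler_wpM2r ?powR_ge0 //.
apply: le_trans (_ : C * (1 + e%:R / 16 * ln 2) <= _); last first.
  rewrite ler_pM2l // /powR (negPf hn0); apply: le_trans (expR_ge1Dx _) _.
  rewrite ler_expR ler_wpM2l ?divr_ge0 // ler_ln ?posrE //; lra.
move: Mn; rewrite nE n2e => Mn.
have : 16 / (C * ln 2) <= e%:R by lra.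
rewrite ler_pdivrMr ?mulr_gt0 //; lra.
Qed.

(** [N * h / k] is of order [n + h], so the point is [h = O(n)], and [delta] serves to exclude [h]
    much larger than [n]. *)
Lemma num_vertices_ratio (delta : R) : 0 < delta ->
  exists2 C : R, 0 < C & forall h k n : nat, admissible h k n ->
    (1 + delta) * h%:R <= k%:R
      \/ (2 + delta) * k%:R <= (num_vertices h k n)%:R :> R ->
    (num_vertices h k n)%:R * h%:R / k%:R <= C * n%:R.
Proof.
move=> d0; set C' := 4 / delta + 3; exists (7 + 3 * C') => [|h k n adm dom].
  by have : 0 < 4 / delta by [rewrite divr_gt0]; rewrite /C'; lra.
have [h6 hk _ n3 kn] := admissibleP adm.
have [m [NE km mk mh m0]] := num_vertices_boundsR adm.
have hR : 6 <= h%:R :> R by rewrite ler_nat.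
have nR : 3 <= n%:R :> R by rewrite ler_nat.
have hkR : h%:R + 1 <= k%:R :> R by rewrite natr1 ler_nat.
have knR : k%:R + 2 <= 2 * n%:R + h%:R :> R.
  by rewrite -natrM -!natrD ler_nat.
have hn : h%:R <= C' * n%:R :> R.
  have dn : delta * h%:R <= 4 * n%:R -> h%:R <= C' * n%:R.
    rewrite mulrC -ler_pdivlMr // => le; rewrite /C' mulrDl; lra.
  case: dom => [dom|]; first by apply: dn; lra.
  (* With two lollipops, [N >= (2 + delta) * k] forces [delta * h <= 4 * n]. With more,
     [2 * (h - 3) + 2 <= k <= 2 * n + h - 2] already gives [h <= 3 * n]. *)
  rewrite NE; case: m m0 {km mh NE} mk => [//|[|m]] _ mk dom.
    by apply: dn; have := ler_wpM2l (ltW d0) hkR; lra.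
  have m2 : 2 <= m.+2%:R :> R by rewrite ler_nat.
  have : 2 * (h%:R - 3) <= m.+2%:R * (h%:R - 3) :> R.
    by rewrite ler_wpM2r //; lra.
  have : 0 <= 4 / delta * n%:R by rewrite mulr_ge0 ?divr_ge0 //; lra.
  rewrite /C' mulrDl; lra.
have k0 : 0 < k%:R :> R by lra.
rewrite ler_pdivrMr //.
have H1 : (m%:R + 1) * h%:R <= 3 * k%:R :> R by lra.
set u : R := 2 * n%:R + (h%:R - 3); have u0 : 0 <= u by rewrite /u; lra.
have H2 := ler_wpM2r u0 H1.
have H3 : 3 * h%:R * k%:R <= 3 * C' * n%:R * k%:R.
  by rewrite ler_pM2r //; lra.
have H4 : k%:R <= n%:R * k%:R :> R by rewrite ler_peMl //; lra.
rewrite NE -/u; move: H2; rewrite /u; lra.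
Qed.

End Asymptotics.

Theorem theorem1 (R : realType) :
  [/\ (* the graph *)
      forall h k n : nat, admissible h k n ->
        exists adj : rel 'I_(num_vertices h k n),
          [/\ symmetric adj, irreflexive adj
            & requires_more_than (hits_score R adj) (hits_tbar R h n) h k],
      (* N ~ 2nk/h + k, as h and k/h tend to infinity, uniformly in n *)
      forall eps : R, 0 < eps ->
        exists M : nat, forall h k n : nat, admissible h k n ->
          (M <= h)%N -> (M * h <= k)%N ->
          `|(num_vertices h k n)%:R - approx_num_vertices R h k n|
             <= eps * approx_num_vertices R h k n,
      (* tbar = h^(Omega(n)) *)
      is_exp_Omega (fun h k n => admissible h k n)
        (fun h _ n => hits_tbar R h n) (fun _ _ n => n%:R)
    & (* tbar = h^(Omega(N h / k)) for N >= 2k, uniformly as long as k/h stays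
         away from 1 or N/k stays away from 2 *)
      forall delta : R, 0 < delta ->
        is_exp_Omega
          (fun h k n => [/\ admissible h k n,
             (2 * k <= num_vertices h k n)%N
             & (1 + delta) * h%:R <= k%:R
               \/ (2 + delta) * k%:R <= (num_vertices h k n)%:R :> R])
          (fun h _ n => hits_tbar R h n)
          (fun h k n => (num_vertices h k n)%:R * h%:R / k%:R)].
Proof.
have [c [M [c0 tbar_ge]]] := tbar_ge_powR R.
split=> [h k n|||delta delta0].
- exact: slow_hits_graph.
- exact: num_vertices_approx.
- by exists c, M.
have [C C0 ratio] := num_vertices_ratio delta0.
(* As [N * h / k <= C * n], dividing [c] by [C] keeps the exponent below [c * n], and the threshold
   [C * M] forces [M <= n]. *)
exists (c / C), (C * M); split=> [|h k n [adm _ dom] Mg].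
  by rewrite divr_gt0.
have gn := ratio h k n adm dom.
apply: le_trans (tbar_ge h k n adm _); last first.
  by rewrite -(ler_pM2l C0); apply: le_trans gn.
have [h6 _ _ _ _] := admissibleP adm.
apply: ler_powR; first by rewrite ler1n; lia.
by rewrite -[leLHS]mulrA ler_pM2l // [leLHS]mulrC ler_pdivrMr // [leRHS]mulrC.
Qed.
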